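(* Let $\Sigma=\{\sigma\}$ be a one-letter alphabet, let $k_1,k_2\geq 1$, let $\mathcal{A}_1=(Q_1,Q_{acc,1},|\psi_0^{(1)}\rangle,\Sigma,\mu_1)$ be a $k_1$-letter QFA and let $\mathcal{A}_2=(Q_2,Q_{acc,2},|\psi_0^{(2)}\rangle,\Sigma,\mu_2)$ be a $k_2$-letter QFA. Let $n_i=|Q_i|$ for $i=1,2$ and $k=\max(k_1,k_2)$. Then $\mathcal{A}_1$ and $\mathcal{A}_2$ are equivalent if and only if they are $\big((n_1+n_2)^4+k-1\big)$-equivalent.
   Context: Let $k\geq 1$. A $k$-letter quantum finite automaton ($k$-letter QFA) is a quintuple $\mathcal{A}=(Q,Q_{acc},|\psi_0\rangle,\Sigma,\mu)$, where $Q$ is a finite set of states, identified with an orthonormal basis of $\mathbb{C}^{|Q|}$; $Q_{acc}\subseteq Q$ is the set of accepting states; $|\psi_0\rangle\in\mathbb{C}^{|Q|}$ is a unit vector (initial state); $\Sigma$ is a finite input alphabet; and $\mu$ assigns to each string $w\in(\{\Lambda\}\cup\Sigma)^k$ a unitary matrix $\mu(w)$ on $\mathbb{C}^{|Q|}$, where $\Lambda\notin\Sigma$ is a blank symbol. For $x=\sigma_1\cdots\sigma_m\in\Sigma^*$, put $\sigma_j=\Lambda$ for $j\leq 0$ and define $\overline{\mu}(x)=\prod_{i=1}^m\mu(\sigma_{i-k+1}\sigma_{i-k+2}\cdots\sigma_i)$, the factors being ordered from left to right by increasing $i$ (and $\overline{\mu}$ of the empty string is the identity). Let $P_{acc}$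 be the orthogonal projector onto the span of $Q_{acc}$. The accepting probability of $x$ is $P_{\mathcal{A}}(x)=\|\langle\psi_0|\overline{\mu}(x)P_{acc}\|^2$. Two multi-letter QFAs $\mathcal{A}_1,\mathcal{A}_2$ over the same input alphabet $\Sigma$ are equivalent if $P_{\mathcal{A}_1}(w)=P_{\mathcal{A}_2}(w)$ for all $w\in\Sigma^*$, and $t$-equivalent if $P_{\mathcal{A}_1}(w)=P_{\mathcal{A}_2}(w)$ for all $w\in\Sigma^*$ of length $|w|\leq t$. *)

(* Defs.v *)
From HB Require Import structures.
From mathcomp Require Import all_boot all_order all_algebra.
From mathcomp Require Import spectral complex reals.

Set Implicit Arguments.
Unset Strict Implicit.
Unset Printing Implicit Defensive.

Import Order.TTheory GRing.Theory Num.Theory.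
Local Open Scope ring_scope.
Local Open Scope sesquilinear_scope.

(* Multi-letter quantum finite automata over the complex numbers [R[i]].
   The blank symbol is [None : option Sigma].  The state [q] is identified with
   the basis vector of index [enum_rank q]. *)
Record qfa (R : realType) (k : nat) (Sigma : finType) := QFA {
  state : finType;
  accept : {set state};
  init : 'cV[R[i]]_#|state|;
  trans : k.-tuple (option Sigma) -> 'M[R[i]]_#|state|;
  init_unit : init^t* *m init = 1%:M;
  trans_unitary : forall w, trans w \is unitarymx
}.

(* Letters are numbered from 1; nonpositive positions hold the blank. *)
Definition letter (Sigma : finType) (x : seq Sigma) (p : int) : option Sigma :=
  if p is Posz q.+1 then onth x q else None.

(* The [k] symbols at positions i-k+1, ..., i; the index [j] starts at 0. *)
Definition window (Sigma : finType) (k : nat) (x : seq Sigma) (i : nat) :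
    k.-tuple (option Sigma) :=
  [tuple letter x (i%:Z - k%:Z + 1 + (j : nat)%:Z) | j < k].

Section Acceptance.
Variables (R : realType) (k : nat) (Sigma : finType) (A : qfa R k Sigma).

Definition mubar (x : seq Sigma) : 'M[R[i]]_#|state A| :=
  \big[mulmx/1%:M]_(1 <= i < (size x).+1) trans A (window k x i).

Definition proj_acc : 'M[R[i]]_#|state A| :=
  \sum_(q in accept A) delta_mx (enum_rank q) (enum_rank q).

(* [dotmx v v] is the squared Hermitian norm of the row vector [v]. *)
Definition acc_prob (x : seq Sigma) : R[i] :=
  let v := (init A)^t* *m mubar x *m proj_acc in dotmx v v.

End Acceptance.

Definition qfa_equiv (R : realType) (Sigma : finType) (k1 k2 : nat)
    (A1 : qfa R k1 Sigma) (A2 : qfa R k2 Sigma) : Prop :=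
  forall w : seq Sigma, acc_prob A1 w = acc_prob A2 w.

Definition qfa_t_equiv (R : realType) (Sigma : finType) (k1 k2 : nat) (t : nat)
    (A1 : qfa R k1 Sigma) (A2 : qfa R k2 Sigma) : Prop :=
  forall w : seq Sigma, (size w <= t)%N -> acc_prob A1 w = acc_prob A2 w.

(* Main.v *)
(** On unary words of length at least [k - 1] both automata read the same window
    over and over, so the accepting probability of a word of length [k - 1 + j]
    is [u M^j P P^* (M^j)^* u^*]: a linear functional of the [j]-th iterate of
    the linear map [X |-> M X M^*] on square matrices.  The difference of the two
    probabilities is thus governed by a linear map in dimension
    [n1 ^ 2 + n2 ^ 2 <= (n1 + n2) ^ 4], and by Cayley-Hamilton it vanishes for
    every [j] once it vanishes for [j < n1 ^ 2 + n2 ^ 2]. *)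
Require Import Defs.
From mathcomp Require Import all_boot all_order all_algebra.
From mathcomp Require Import spectral complex reals.
From mathcomp Require Import zify.

Import Order.TTheory GRing.Theory Num.Theory.
Local Open Scope ring_scope.
Local Open Scope sesquilinear_scope.

(** Modulo the characteristic polynomial of [A], ['X^j] has a remainder of degree below [n], so
    [A ^+ j] is a linear combination of the powers already handled. *)
Lemma mulmx_exp_eq0 (F : fieldType) (n p : nat) (u : 'rV[F]_n) (A : 'M[F]_n)
    (c : 'M[F]_(n, p)) :
  (forall j, (j < n)%N -> u *m A ^+ j *m c = 0) ->
  forall j, u *m A ^+ j *m c = 0.
Proof.
case: n u A c => [|n] u A c small j; first by rewrite [u]thinmx0 !mul0mx.
have eval_eq0 (q : {poly F}) : (size q <= n.+1)%N -> u *m horner_mx A q *m c = 0.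
  move=> size_q; rewrite -[q]coefK poly_def rmorph_sum mulmx_sumr mulmx_suml.
  rewrite big1 // => i _ /=.
  rewrite linearZ rmorphXn /= horner_mx_X -scalemxAr -scalemxAl small ?scaler0 //.
  exact: leq_trans (ltn_ord i) size_q.
have -> : A ^+ j = horner_mx A ('X^j %% char_poly A).
  rewrite -[in LHS](horner_mx_X A) -rmorphXn /=.
  rewrite {1}(divp_eq 'X^j (char_poly A)) rmorphD rmorphM /=.
  by rewrite Cayley_Hamilton mulr0 add0r.
apply: eval_eq0; rewrite -ltnS -(size_char_poly A) ltn_modp.
exact: monic_neq0 (char_poly_monic A).
Qed.

Lemma block_diag_mx_exp (F : comNzRingType) (m n : nat) (A : 'M[F]_m)
    (B : 'M[F]_n) (j : nat) :
  (block_mx A 0 0 B) ^+ j = block_mx (A ^+ j) 0 0 (B ^+ j).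
Proof.
elim: j => [|j IHj]; first by rewrite !expr0 -scalar_mx_block.
by rewrite !exprS IHj -!mulmxE mulmx_block !mul0mx !mulmx0 !addr0 !add0r.
Qed.

(** The difference of the two sequences is again of the form [u *m A ^+ j *m c], for a block
    diagonal matrix; its size [m + n] is the bound. *)
Lemma eq_mulmx_exp (F : fieldType) (m n p : nat)
    (u : 'rV[F]_m) (A : 'M[F]_m) (c : 'M[F]_(m, p))
    (v : 'rV[F]_n) (B : 'M[F]_n) (d : 'M[F]_(n, p)) :
  (forall j, (j < m + n)%N -> u *m A ^+ j *m c = v *m B ^+ j *m d) ->
  forall j, u *m A ^+ j *m c = v *m B ^+ j *m d.
Proof.
have diffE j : row_mx u v *m (block_mx A 0 0 B) ^+ j *m col_mx c (- d)
             = u *m A ^+ j *m c - v *m B ^+ j *m d.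
  rewrite block_diag_mx_exp mul_row_block !mulmx0 addr0 add0r mul_row_col.
  by rewrite mulmxN.
move=> small j; apply/eqP; rewrite -subr_eq0 -diffE; apply/eqP.
by apply: mulmx_exp_eq0 => i /small E; rewrite diffE E subrr.
Qed.

Section Conjugation.
Context {C : numClosedFieldType} {n : nat}.
Implicit Types M X : 'M[C]_n.

(** Rectangular [M] is allowed so that a row vector ([m = 1]) turns the same construction into the
    final linear functional, with values in 1 x 1 matrices. *)
Definition lin_conj {m : nat} (M : 'M[C]_(m, n)) :
    'M[C]_(n * n, m * m) :=
  lin_mulmx M *m lin_mulmxr (M^t*).

Lemma mxvec_lin_conj {m : nat} (M : 'M[C]_(m, n)) X :
  mxvec X *m lin_conj M = mxvec (M *m X *m M^t*).
Proof. by rewrite /lin_conj mulmxA !mul_vec_lin. Qed.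

Lemma mxvec_lin_conj_exp M X (j : nat) :
  mxvec X *m lin_conj M ^+ j = mxvec (M ^+ j *m X *m (M ^+ j)^t*).
Proof.
elim: j => [|j IHj].
  by rewrite !expr0 mulmx1 mul1mx trmx1 map_mx1 mulmx1.
rewrite exprSr -mulmxE mulmxA IHj mxvec_lin_conj.
by rewrite exprS -mulmxE trmx_mul map_mxM !mulmxA.
Qed.

End Conjugation.

Section UnaryWords.
Variables (R : realType) (k : nat) (Sigma : finType) (A : qfa R k Sigma).
Variable s : Sigma.

Lemma letter_nseq (m i : nat) (p : int) :
  (i <= m)%N -> p <= i%:Z -> letter (nseq m s) p = letter (nseq i s) p.
Proof.
case: p => [[|q]|q] //= le_im lt_qi.
have lt_qm : (q < m)%N := leq_trans lt_qi le_im.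
by rewrite !onth_nseq lt_qm [(q < i)%N]lt_qi.
Qed.

(** A window ending at position [i] sees no later letter. *)
Lemma window_nseq (m i : nat) :
  (i <= m)%N -> window k (nseq m s) i = window k (nseq i s) i.
Proof.
move=> le_im; apply: eq_mktuple => j; apply: letter_nseq => //.
have := ltn_ord j; lia.
Qed.

Lemma window_nseq_full (i : nat) :
  (k <= i)%N -> window k (nseq i s) i = [tuple Some s | _ < k].
Proof.
move=> le_ki; apply: eq_mktuple => j; have lt_jk := ltn_ord j.
have -> : i%:Z - k%:Z + 1 + (j : nat)%:Z = (i - k + j).+1%:Z by lia.
by rewrite /= onth_nseq (_ : i - k + j < i)%N; last lia.
Qed.

Let M := trans A [tuple Some s | _ < k].

(** The first window past the prefix ends at position [K.+1]; once this is at least [k], neither it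
    nor any later window contains a blank, so each contributes the factor [M]. *)
Lemma mubar_nseqD (K j : nat) :
  (k <= K.+1)%N -> mubar A (nseq (K + j) s) = mubar A (nseq K s) *m M ^+ j.
Proof.
move=> le_kK; elim: j => [|j IHj]; first by rewrite addn0 expr0 mulmx1.
rewrite exprSr -mulmxE mulmxA -IHj addnS /mubar !size_nseq.
rewrite mulmxE idmxE big_nat_recr //.
rewrite window_nseq_full; last by lia.
congr (_ *m _); apply: eq_big_nat => i /andP[_ lt_i].
by rewrite (@window_nseq (K + j).+1) 1?(@window_nseq (K + j) i) //; lia.
Qed.

(** The prefix of length [K] stands to the left of [M ^+ j], so it goes into the last functional,
    and only the middle factor depends on [j]. *)
Lemma acc_prob_nseqD (K j : nat) :
  (k <= K.+1)%N ->
  mxvec ((acc_prob A (nseq (K + j) s))%:M : 'M_1) =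
  mxvec (proj_acc A *m (proj_acc A)^t*) *m lin_conj M ^+ j
    *m lin_conj ((init A)^t* *m mubar A (nseq K s)).
Proof.
move=> le_kK; rewrite mxvec_lin_conj_exp mxvec_lin_conj; congr mxvec.
rewrite /acc_prob dotmxE -mx11_scalar (@mubar_nseqD K j le_kK).
move: (mubar A _) => B; by rewrite !trmx_mul !map_mxM !mulmxA.
Qed.

End UnaryWords.

Local Open Scope nat_scope.

Theorem theorem9 (R : realType) (Sigma : finType) (hSigma : #|Sigma| = 1)
    (k1 k2 : nat) (hk1 : 1 <= k1) (hk2 : 1 <= k2)
    (A1 : qfa R k1 Sigma) (A2 : qfa R k2 Sigma) :
  qfa_equiv A1 A2 <->
  qfa_t_equiv ((#|state A1| + #|state A2|) ^ 4 + maxn k1 k2 - 1) A1 A2.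
Proof.
split=> [eqv w _|teqv w]; first exact: eqv.
have /fintype1P[s sE] : #|Sigma| == 1 by rewrite hSigma.
have -> : w = nseq (size w) s by apply/all_pred1P/allP => x _; rewrite /= sE.
(* The least [K] with [k1 <= K.+1] and [k2 <= K.+1]; shorter words lie within the tested lengths. *)
set K := (maxn k1 k2).-1.
have [lt_wK|le_Kw] := ltnP (size w) K; first by apply: teqv; rewrite size_nseq; lia.
rewrite -(subnKC le_Kw); move: (size w - K) => j.
suff /(can_inj mxvecK)/matrixP/(_ ord0 ord0) :
    mxvec ((acc_prob A1 (nseq (K + j) s))%:M : 'M_1)%R =
    mxvec ((acc_prob A2 (nseq (K + j) s))%:M : 'M_1)%R.
  by rewrite !mxE eqxx.
rewrite !acc_prob_nseqD; try lia.
(* Here [i] is below the sum of the squared state counts, the dimension of the two conjugation maps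
   together. *)
apply: eq_mulmx_exp => i lt_i; rewrite -!acc_prob_nseqD; try lia.
rewrite teqv // size_nseq.
have le_dim (a b : nat) : a * a + b * b <= (a + b) ^ 4.
  (* Raising the exponent from 2 to 4 needs a positive base. *)
  case: (posnP (a + b)) => [|ab_gt0]; first by lia.
  apply: (@leq_trans ((a + b) ^ 2)); first by nia.
  exact: leq_pexp2l.
have := le_dim #|state A1| #|state A2|; lia.
Qed.
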